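(* Let $\Delta$ and $\Gamma$ be simplicial complexes with disjoint vertex sets. If $\Delta$ and $\Gamma$ each satisfy the spectral recursion, then so does their disjoint union $\Delta\cup\Gamma$ (a simplicial complex on the union of the two vertex sets).
   Context: A simplicial complex $\Delta$ on a finite vertex set $V$ is a collection of subsets of $V$ (faces) closed under taking subsets. The empty set is a face (of dimension $-1$) of every complex that has at least one face; the empty complex $\emptyset$ (no faces at all) is allowed; an element $v\in V$ need not satisfy $\{v\}\in\Delta$. In $\Delta\cup\Gamma$ the empty face is shared. Put $\dim F=|F|-1$. A simplicial pair $(\Delta,\Delta')$ consists of two simplicial complexes on the same vertex set; pairs with the same set difference $\Delta\setminus\Delta'$ are identified, and a single complex $\Delta$ is the pair $(\Delta,\emptyset)$. For $i\ge -1$, $C_i(\Delta,\Delta';\mathbb R)$ is the real vector space of formal linear combinations of oriented $i$-dimensional faces $[F]$, $F\in\Delta\setminus\Delta'$, and $\partial_i\colon C_i\to C_{i-1}$ is the usual signed simplicial boundary operator with all terms outside $\Delta\setminus\Delta'$ dropped; $\partial_i^*$ is its adjoint (transposed matrix in the natural bases). The Laplacian is $L_i(\Delta,\Delta')=\partial_{i+1}\partial_{i+1}^*+\partial_i^*\partial_i$, and $\mathbf s_i(\Delta,\Delta')$ is the multiset of its eigenvalues (non-negative reals). The spectrum polynomial is the generating function $$S_{(\Delta,\Delta')}(t,q)=\sum_{i\ge 0}t^i\sum_{\lambda\in\mathbf s_{i-1}(\Delta,\Delta')}q^\lambda,\qquad S_\Delta=S_{(\Delta,\emptyset)}$$ (exponents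 of $q$ may be arbitrary non-negative reals). For $e\in V$, the deletion $\Delta-e=\{F\in\Delta: e\notin F\}$ and the contraction $\Delta/e=\{F\setminus\{e\}: F\in\Delta,\ e\in F\}$ are simplicial complexes on vertex set $V\setminus\{e\}$. $\Delta$ satisfies the spectral recursion with respect to $e\in V$ if $$S_\Delta(t,q) = q\,S_{\Delta-e}(t,q) + qt\,S_{\Delta/e}(t,q) + (1-q)\,S_{(\Delta-e,\Delta/e)}(t,q),$$ and $\Delta$ satisfies the spectral recursion if this holds for every $e\in V$. *)

(* Defs.v *)
From HB Require Import structures.
From mathcomp Require Import all_boot all_order all_algebra.
From mathcomp Require Import finmap interval_inference reals polyrcf.
From mathcomp.multinomials Require Import monalg.

Set Implicit Arguments.
Unset Strict Implicit.
Unset Printing Implicit Defensive.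

Import Order.TTheory GRing.Theory Num.Theory.

Local Open Scope ring_scope.

(** * Simplicial complexes and pairs

    All vertex sets live in an ambient finite type [T]; [set0] is the empty
    complex, [[set set0]] is the complex whose only face is the empty face.
    [D] on [V] may miss some singletons [[set v]] with [v \in V]. *)

Section Complexes.
Variable T : finType.
Implicit Types (V W F G : {set T}) (D : {set {set T}}) (e : T).

Definition simplicial_complex V D : Prop :=
  (forall F, F \in D -> F \subset V) /\
  (forall F G, F \in D -> G \subset F -> G \in D).

Definition deletion D e : {set {set T}} := [set F in D | e \notin F].

Definition contraction D e : {set {set T}} := [set F :\ e | F in D & e \in F].

Lemma deletion_complex V D e :
  simplicial_complex V D -> simplicial_complex (V :\ e) (deletion D e).
Proof.
move=> [DV Dsub]; split=> [F | F G]; rewrite inE => /andP[FD eF].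
  by rewrite subsetD1 DV.
move=> GF; rewrite inE (Dsub _ _ FD GF) /=.
by apply: contraNN eF => /(subsetP GF).
Qed.

Lemma contraction_complex V D e :
  simplicial_complex V D -> simplicial_complex (V :\ e) (contraction D e).
Proof.
move=> [DV Dsub]; split=> [F | F G] /imsetP[H]; rewrite inE => /andP[HD eH] ->.
  by apply: setSD; exact: DV.
rewrite subsetD1 => /andP[GH eG]; apply/imsetP; exists (e |: G).
  by rewrite inE setU11 (Dsub H) // subUset sub1set eH.
by rewrite setU1K.
Qed.

Lemma union_complex V W D D' :
  simplicial_complex V D -> simplicial_complex W D' ->
  simplicial_complex (V :|: W) (D :|: D').
Proof.
move=> [DV Ds] [DW Ds']; split=> [F | F G]; rewrite !inE.
  by case/orP=> [/DV | /DW] /subset_trans; apply; rewrite ?subsetUl ?subsetUr.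
by case/orP=> FD GF; rewrite ?(Ds _ _ FD GF) // (Ds' _ _ FD GF) orbT.
Qed.

Definition dim F : int := #|F|%:Z - 1.

Definition pair_faces D D' (i : int) : {set {set T}} :=
  [set F in D :\: D' | dim F == i].

End Complexes.

(** * Spectra of Laplacians *)

Section Laplacian.
Variables (R : realType) (T : finType).
Implicit Types (F G : {set T}) (D : {set {set T}}).

(** Coefficient of [[G]] in the boundary of [[F]], all faces being oriented by
    the enumeration order of [T]; at most one [v] contributes. *)
Definition incidence G F : R :=
  \sum_(v in F | F :\ v == G)
     (-1) ^+ #|[set u in F | (enum_rank u < enum_rank v)%N]|.

(** The matrix of the boundary map [C_i -> C_j], meant for [j = i - 1]; two
    indices are used so that [boundary D D' i (i + 1)] and
    [boundary D D' (i - 1) i] are composable without casts. *)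
Definition boundary D D' (j i : int) :
    'M[R]_(#|pair_faces D D' j|, #|pair_faces D D' i|) :=
  \matrix_(a, b) incidence (enum_val a) (enum_val b).

Definition laplacian D D' (i : int) : 'M[R]_(#|pair_faces D D' i|) :=
  let up := boundary D D' i (i + 1) in
  let down := boundary D D' (i - 1) i in
  up *m up^T + down^T *m down.

(** The multiset of real eigenvalues, listed with (algebraic) multiplicity. *)
Definition eigenvalues n (A : 'M[R]_n) : seq R :=
  let p := char_poly A in
  flatten [seq nseq (mup x p) x | x <- rootsR p].

Definition spectrum D D' (i : int) : seq R := eigenvalues (laplacian D D' i).

Lemma mem_eigenvalues n (A : 'M[R]_n) x : x \in eigenvalues A -> eigenvalue A x.
Proof.
case/flatten_mapP=> y yp; rewrite mem_nseq => /andP[_ /eqP->].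
have p0 : char_poly A != 0 by rewrite monic_neq0 // char_poly_monic.
by have := roots_on_rootsR p0 y; rewrite yp eigenvalue_root_char => /andP[].
Qed.

Lemma spectrum_ge0 D D' i x : x \in spectrum D D' i -> 0 <= x.
Proof.
have sq_ge0 n (w : 'rV[R]_n) : 0 <= (w *m w^T) 0 0.
  by rewrite mxE sumr_ge0 // => k _; rewrite mxE -expr2 sqr_ge0.
move/mem_eigenvalues/eigenvalueP=> [v vL vn0].
have v_gt0 : 0 < (v *m v^T) 0 0.
  rewrite lt_neqAle sq_ge0 andbT eq_sym; apply: contraNneq vn0.
  rewrite mxE => /psumr_eq0P v0; apply/eqP/rowP=> k; rewrite mxE.
  have /v0/(_ k isT)/eqP : forall k : 'I__, true -> 0 <= v 0 k * v^T k 0.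
    by move=> l _; rewrite mxE -expr2 sqr_ge0.
  by rewrite mxE mulf_eq0 orbb => /eqP.
have := congr1 (fun w => (w *m v^T) 0 0) vL.
rewrite /laplacian mulmxDr mulmxDl -scalemxAl mxE [RHS]mxE !mulmxA.
set U := boundary _ _ _ _; set B := boundary _ _ _ _.
have -> : v *m U *m U^T *m v^T = (v *m U) *m (v *m U)^T.
  by rewrite trmx_mul !mulmxA.
have -> : v *m B^T *m B *m v^T = (v *m B^T) *m (v *m B^T)^T.
  by rewrite trmx_mul trmxK !mulmxA.
by move=> eq_x; rewrite -(pmulr_lge0 _ v_gt0) -eq_x addr_ge0.
Qed.

End Laplacian.

(** * Generating functions in [t] and [q] with real exponents of [q]

    The monomial [t^i q^a] is encoded as [TQ (i, a)]; generating functions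
    live in the commutative ring [{malg int[tqmonom R]}], the monoid algebra of
    [nat * {nonneg R}] (written multiplicatively) with integer coefficients. *)

Section Monomials.
Variable R : realType.

Record tqmonom : Type := TQ { tqexp : nat * {nonneg R} }.

HB.instance Definition _ := [isNew for tqexp].
HB.instance Definition _ := [Choice of tqmonom by <:].

Definition tq_one : tqmonom := TQ (0%N, 0%:nng).

Definition tq_mul (m n : tqmonom) : tqmonom :=
  TQ (((tqexp m).1 + (tqexp n).1)%N,
      ((tqexp m).2%:num + (tqexp n).2%:num)%:nng).

Let tq_eq (i j : nat) (a b : {nonneg R}) :
  i = j -> a%:num = b%:num -> TQ (i, a) = TQ (j, b).
Proof. by move=> -> ab; congr (TQ (_, _)); apply/val_inj. Qed.

Fact tq_mulA : associative tq_mul.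
Proof. by move=> ? ? ?; apply: tq_eq => /=; rewrite ?addnA ?addrA. Qed.

Fact tq_mulC : commutative tq_mul.
Proof. by move=> ? ?; apply: tq_eq => /=; [exact: addnC | exact: addrC]. Qed.

Fact tq_mul1m : left_id tq_one tq_mul.
Proof. by case=> [[i a]]; apply: tq_eq => //=; rewrite add0r. Qed.

Fact tq_mulm1 : right_id tq_one tq_mul.
Proof. by move=> m; rewrite tq_mulC tq_mul1m. Qed.

Fact tq_unitm m n : tq_mul m n = tq_one -> m = tq_one /\ n = tq_one.
Proof.
case: m n => [[i a]] [[j b]] [/eqP]; rewrite addn_eq0 => /andP[/eqP-> /eqP->].
move=> /eqP; rewrite paddr_eq0 // => /andP[/eqP a0 /eqP b0].
by split; apply: tq_eq.
Qed.

HB.instance Definition _ := Choice_isMonomialDef.Build tqmonom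
  tq_mulA tq_mul1m tq_mulm1 tq_unitm.
HB.instance Definition _ := MonomialDef_isConomialDef.Build tqmonom tq_mulC.

Definition tvar : {malg int[tqmonom]} := << TQ (1%N, 0%:nng) >>.

Definition qpow (a : {nonneg R}) : {malg int[tqmonom]} := << TQ (0%N, a) >>.

Definition qvar : {malg int[tqmonom]} := qpow 1%:nng.

Lemma malgU_mul (K : monomType) (S : nzRingType) (k l : K) :
  << k >> * << l >> = << mmul k l >> :> {malg S[K]}.
Proof. by rewrite malgME !msuppU1 !big_seq_fset1 !mcoeffU1 !eqxx mulr1. Qed.

Lemma tvarX_qpow i a : tvar ^+ i * qpow a = << TQ (i, a) >>.
Proof.
elim: i => [|i IH]; first by rewrite expr0 mul1r.
rewrite exprS -mulrA IH malgU_mul.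
have -> : mmul (TQ (1%N, 0%:nng)) (TQ (i, a)) = TQ (i.+1, a).
  by congr (TQ (_, _)); apply/val_inj; rewrite /= add0r.
by [].
Qed.

End Monomials.

Arguments tvar {R}.
Arguments qvar {R}.

Section SpectralRecursion.
Variables (R : realType) (T : finType).
Implicit Types (V : {set T}) (D : {set {set T}}).

(** There are no faces of dimension [i - 1] for [i > #|T|], whence the range of
    [i].  The absolute value only serves to type the exponents as nonnegative
    reals: by [spectrum_ge0], [`|x| = x]. *)
Definition spectrum_poly D D' : {malg int[tqmonom R]} :=
  \sum_(i < #|T|.+1) tvar ^+ i *
    \sum_(x <- spectrum R D D' (i%:Z - 1)) qpow `|x|%:nng.

Definition spectral_recursion_at D (e : T) : Prop :=
  spectrum_poly D set0 =
    qvar * spectrum_poly (deletion D e) set0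
    + qvar * tvar * spectrum_poly (contraction D e) set0
    + (1 - qvar) * spectrum_poly (deletion D e) (contraction D e).

Definition spectral_recursion V D : Prop :=
  forall e, e \in V -> spectral_recursion_at D e.

End SpectralRecursion.

(* Main.v *)
Require Import Defs.
From mathcomp Require Import all_boot all_order all_algebra reals.
From mathcomp Require Import perm interval_inference polyrcf ring zify.
From mathcomp.multinomials Require Import monalg.

Set Implicit Arguments.
Unset Strict Implicit.
Unset Printing Implicit Defensive.

Import Order.TTheory GRing.Theory Num.Theory.

Local Open Scope ring_scope.

(** Let [n] be the number of vertices of a complex [D] that has the empty face.
    Removing the empty face from [D] removes the only eigenvalue [n] of [L_{-1}]
    and, if [n > 0], turns one eigenvalue [n] of [L_0] into [0]: the all-ones vector is in
    the kernel of the graph Laplacian, and the down part of [L_0] is the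
    all-ones matrix.  Hence [S_D = S_(D, {set0}) + q^n + t (q^n - 1)].  Without
    the empty face, a disjoint union has block diagonal Laplacians, so the
    spectrum polynomials add up.  The same holds for the pair in the recursion,
    where the contraction already contains the empty face.  The recursion for
    the union at a vertex of one side is then a polynomial identity using only
    the recursion of that side, with one vertex fewer in the deletion. *)

(** Both sides equal [x * \det (block_mx 1 v u P)]. *)
Lemma det_sub_rank1 (K : comNzRingType) n (P : 'M[K]_n)
    (u : 'cV_n) (v : 'rV_n) (x : K) :
  P *m u = x *: u -> x * \det (P - u *m v) = (x - (v *m u) 0 0) * \det P.
Proof.
move=> Pu; pose Z := block_mx (1%:M : 'M_1) v u P.
have detZ : \det Z = \det (P - u *m v).
  have : Z *m block_mx 1%:M (- v) 0 1%:M
      = block_mx (1%:M : 'M_1) 0 u (P - u *m v).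
    rewrite mulmx_block !mul1mx !mulmx1 !mulmx0 !addr0 mulmxN addNr.
    by rewrite [- _ + P]addrC.
  move/(congr1 determinant).
  by rewrite det_mulmx det_lblock det_ublock !det1 !mulr1 mul1r.
have <- : \det Z * x = x * \det (P - u *m v) by rewrite detZ mulrC.
have -> : \det Z * x = \det (Z *m block_mx x%:M 0 (- u) 1%:M).
  by rewrite det_mulmx det_lblock det1 mulr1 det_scalar1.
rewrite mulmx_block !mulmx0 !mulmx1 mul1mx !add0r !mulmxN Pu.
rewrite mul_mx_scalar subrr det_ublock det_mx11 !mxE mulr1n; congr (_ * _).
Qed.

(** * Characteristic polynomials under reindexing, block sums and all-ones updates *)

Section CharPoly.
Variable K : comNzRingType.

(** The same permutation acts on rows and columns, so its two signs cancel. Allowing distinct [m]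
    and [n] avoids casts between equal sizes. *)
Lemma char_poly_reindex m n (A : 'M[K]_m) (B : 'M[K]_n) (f : 'I_m -> 'I_n) :
  bijective f -> (forall i j, A i j = B (f i) (f j)) ->
  char_poly A = char_poly B.
Proof.
move=> f_bij AB; have mn : m = n by have := bij_eq_card f_bij; rewrite !card_ord.
subst n; have f_inj := bij_inj f_bij; pose s := perm f_inj.
rewrite /char_poly.
have -> : char_poly_mx A = row_perm s (col_perm s (char_poly_mx B)).
  by apply/matrixP=> i j; rewrite !mxE !permE AB (inj_eq f_inj).
rewrite row_permE col_permE !det_mulmx !det_perm mulrCA.
by rewrite odd_permV -signr_addb addbb mulr1.
Qed.

Lemma char_poly_block_diag m n (A : 'M[K]_m) (B : 'M[K]_n) :
  char_poly (block_mx A 0 0 B) = char_poly A * char_poly B.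
Proof.
rewrite /char_poly -(det_ublock _ 0); congr (\det _).
rewrite /char_poly_mx map_block_mx !map_mx0 scalar_mx_block.
by rewrite opp_block_mx add_block_mx !oppr0 !addr0.
Qed.

(** The all-ones matrix is a column of ones times a row of ones, whose product in the other order is
    [n]. The column is an eigenvector of [char_poly_mx A] for ['X], so [det_sub_rank1] applies over
    polynomials. *)
Lemma char_poly_add_const n (A : 'M[K]_n) :
  A *m (const_mx 1 : 'cV_n) = 0 ->
  'X * char_poly (A + const_mx 1) = ('X - n%:R%:P) * char_poly A.
Proof.
move=> A1; pose u : 'cV[{poly K}]_n := const_mx 1.
pose v : 'rV[{poly K}]_n := const_mx 1.
have Au : char_poly_mx A *m u = 'X *: u.
  rewrite /char_poly_mx mulmxBl mul_scalar_mx.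
  have -> : u = map_mx (@polyC K) (const_mx 1) by rewrite map_const_mx.
  by rewrite -map_mxM A1 map_mx0 subr0.
have := det_sub_rank1 v Au.
have -> : (v *m u) 0 0 = n%:R%:P.
  rewrite mxE (eq_bigr (fun=> 1)) => [|i _]; last by rewrite !mxE mulr1.
  by rewrite sumr_const card_ord rmorph_nat.
move=> <-; congr (_ * \det _); apply/matrixP=> i j; rewrite !mxE.
by rewrite big_ord1 !mxE mulr1 rmorphD rmorph1 opprD addrA.
Qed.

End CharPoly.

(** * Matrices indexed by finite sets *)

Section SetMx.
Variables (K : comNzRingType) (I : finType).
Implicit Types (A B : {set I}) (M : I -> I -> K).

Definition set_mx A M : 'M[K]_#|A| :=
  \matrix_(a, b) M (enum_val a) (enum_val b).

(** The enumeration of the union may interleave [A] and [B]; reindexing by [f] lists [A] first and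
    then [B], which makes the matrix block diagonal. *)
Lemma char_poly_set_mxU A B M :
  [disjoint A & B] ->
  (forall a b, a \in A -> b \in B -> M a b = 0 /\ M b a = 0) ->
  char_poly (set_mx (A :|: B) M)
  = char_poly (set_mx A M) * char_poly (set_mx B M).
Proof.
move=> dAB M0; rewrite -char_poly_block_diag.
pose g (i : 'I_(#|A| + #|B|)) :=
  match split i with inl a => enum_val a | inr b => enum_val b end.
have gAB i : g i \in A :|: B.
  by rewrite /g inE; case: (split i) => k; rewrite enum_valP ?orbT.
have AB a b : a \in A -> b \in B -> a <> b.
  by move=> aA bB ab; have := disjointFr dAB aA; rewrite ab bB.
have g_inj : injective g.
  move=> i j; rewrite -{2}(splitK i) -{2}(splitK j) /g.
  case: (split i) (split j) => [k [l|l]|k [l|l]].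
  - by move/enum_val_inj=> ->.
  - by move/AB; case; apply: enum_valP.
  - by move/esym/AB; case; apply: enum_valP.
  - by move/enum_val_inj=> ->.
pose f i := enum_rank_in (gAB i) (g i).
have fK i : enum_val (f i) = g i by exact: enum_rankK_in.
apply/esym/(@char_poly_reindex _ _ _ _ _ f).
  apply: inj_card_bij.
    by move=> i j /(congr1 enum_val); rewrite !fK; exact: g_inj.
  rewrite !card_ord cardsU (_ : A :&: B = set0) ?cards0 ?subn0 //.
  by apply/eqP; rewrite setI_eq0.
move=> i j; rewrite [RHS]mxE !fK /g -{1}(splitK i) -{1}(splitK j).
case: (split i) (split j) => [k [l|l]|k [l|l]] /=.
- by rewrite block_mxEul mxE.
- by rewrite block_mxEur mxE (M0 _ _ (enum_valP _) (enum_valP _)).1.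
- by rewrite block_mxEdl mxE (M0 _ _ (enum_valP _) (enum_valP _)).2.
- by rewrite block_mxEdr mxE.
Qed.

Lemma char_poly_set_mx1 x M : char_poly (set_mx [set x] M) = 'X - (M x x)%:P.
Proof.
have -> : 'X - (M x x)%:P = char_poly ((M x x)%:M : 'M_1).
  by rewrite /char_poly det_mx11 !mxE mulr1n.
apply/esym/(@char_poly_reindex _ _ _ _ _ (fun=> enum_rank_in (set11 x) x)).
  by apply: inj_card_bij;
    [move=> i j _; rewrite !ord1 | rewrite !card_ord cards1].
by move=> i j; rewrite !ord1 !mxE mulr1n enum_rankK_in ?set11.
Qed.

Lemma char_poly_set_mx0 M : char_poly (set_mx set0 M) = 1.
Proof.
have f0 : 'I_#|@set0 I| -> 'I_0 by rewrite cards0.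
rewrite -[RHS](det_mx00 (char_poly_mx (0 : 'M[K]_0))).
apply: (@char_poly_reindex _ _ _ _ _ f0) => [|i]; last by case: (f0 i).
by exists (fun i : 'I_0 => False_rect _ (let: Ordinal k p := i in notF p)) => i;
  [case: (f0 i) | case: i].
Qed.

Lemma eq_set_mx A M N :
  {in A &, M =2 N} -> set_mx A M = set_mx A N.
Proof.
by move=> MN; apply/matrixP=> a b; rewrite !mxE MN ?enum_valP.
Qed.

End SetMx.

Lemma mem_rootsR (R : rcfType) (p : {poly R}) x :
  p != 0 -> (x \in rootsR p) = root p x.
Proof. by move=> p0; rewrite -(roots_on_rootsR p0 x). Qed.

(** * Weighted sums over real roots *)

Section RootSum.
Variables (R : realType) (Z : zmodType) (G : R -> Z).
Implicit Types p q : {poly R}.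

(** Additive on products, so that factorizations of characteristic polynomials become sums of
    generating functions. *)
Definition root_sum p : Z := \sum_(x <- rootsR p) G x *+ mup x p.

Lemma sum_eigenvalues n (A : 'M[R]_n) :
  \sum_(x <- eigenvalues A) G x = root_sum (char_poly A).
Proof.
rewrite /eigenvalues big_flatten big_map; apply: eq_bigr => x _.
by rewrite big_nseq; elim: mup => //= k ->; rewrite mulrS.
Qed.

(** Points that are not roots have multiplicity 0, so several polynomials can be summed over one
    common list. *)
Lemma root_sum_uniq p (s : seq R) :
  p != 0 -> uniq s -> {subset rootsR p <= s} ->
  root_sum p = \sum_(x <- s) G x *+ mup x p.
Proof.
move=> p0 us sub; rewrite (bigID (mem (rootsR p))) /= [X in _ + X]big1.
  rewrite addr0 -big_filter; apply: perm_big; apply: uniq_perm.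
  - exact: uniq_roots.
  - exact: filter_uniq.
  by move=> x; rewrite mem_filter; case: (boolP (x \in rootsR p)) => // /sub.
by move=> x xp; rewrite mupNroot ?mulr0n // -mem_rootsR.
Qed.

Lemma root_sumM p q :
  p != 0 -> q != 0 -> root_sum (p * q) = root_sum p + root_sum q.
Proof.
move=> p0 q0; have pq0 : p * q != 0 by rewrite mulf_neq0.
pose s := undup (rootsR p ++ rootsR q ++ rootsR (p * q)).
rewrite !(@root_sum_uniq _ s) ?undup_uniq //; first last.
- by move=> x xr; rewrite mem_undup !mem_cat xr ?orbT.
- by move=> x xr; rewrite mem_undup !mem_cat xr ?orbT.
- by move=> x xr; rewrite mem_undup !mem_cat xr ?orbT.
rewrite -big_split; apply: eq_bigr => x _.
by rewrite /= mupM // mulrnDr.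
Qed.

Lemma root_sum_XsubC a : root_sum ('X - a%:P) = G a.
Proof.
have Xa0 : 'X - a%:P != 0 by rewrite polyXsubC_eq0.
rewrite (@root_sum_uniq _ [:: a]) //.
  by rewrite big_seq1 -['X - _]expr1 mup_XsubCX eqxx.
by move=> x; rewrite mem_rootsR // root_XsubC inE.
Qed.

Lemma root_sum1 : root_sum 1 = 0.
Proof. by rewrite /root_sum rootsRC big_nil. Qed.

End RootSum.

(** The next three facts are stated for opaque ring elements because [ring] and
    [rewrite], applied to concrete spectrum polynomials, try to decide their
    equality by unfolding determinants. *)
Lemma sum_eq_from2 (Z : comNzRingType) (f g : nat -> Z) (t a : Z) n :
  f 0 = a -> g 0 = 0 -> 1 + f 1 = a + g 1 -> (n = 0 -> a = 1) ->
  (forall i, (1 < i)%N -> f i = g i) ->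
  \sum_(0 <= i < n.+1) t ^+ i * f i
  = \sum_(0 <= i < n.+1) t ^+ i * g i + a + t * (a - 1).
Proof.
move=> f0 g0 fg1 a1 fg; rewrite !(big_ltn (ltn0Sn n)) f0 g0 !expr0.
(* For [n = 0] the sums stop before index 1, where the correction [t * (a - 1)] belongs; it vanishes
   because [a = 1]. *)
rewrite mulr0 mul1r add0r; case: n a1 => [/(_ erefl)-> | n _].
  by rewrite !big_geq // subrr mulr0 !addr0 ?add0r.
rewrite !(big_ltn (isT : (1 < n.+2)%N)).
have -> : f 1 = a + g 1 - 1 by rewrite -fg1 addrC addKr.
have -> : \sum_(2 <= i < n.+2) t ^+ i * f i = \sum_(2 <= i < n.+2) t ^+ i * g i.
  by apply: eq_big_nat => i /andP[i2 _]; rewrite fg.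
ring.
Qed.

Lemma recursion_algebra0 (Z : comNzRingType) (q s : Z) :
  s = q * s + (1 - q) * s.
Proof. by ring. Qed.

Lemma recursion_algebra (Z : comNzRingType) (q t sD sE del con pair : Z) n m :
  sD + q ^+ n.+1 + t * (q ^+ n.+1 - 1)
  = q * (del + q ^+ n + t * (q ^+ n - 1)) + q * t * con + (1 - q) * pair ->
  sD + sE + q ^+ (n.+1 + m) + t * (q ^+ (n.+1 + m) - 1)
  = q * (del + sE + q ^+ (n + m) + t * (q ^+ (n + m) - 1)) + q * t * con
    + (1 - q) * (pair + sE).
Proof.
set r := _ + (1 - q) * pair => sDE.
(* After eliminating [sD], the terms in [sE] agree since q + (1 - q) = 1, and the constant terms of
   the two corrections cancel on each side. *)
have -> : sD = r - q ^+ n.+1 - t * (q ^+ n.+1 - 1) by rewrite -sDE; ring.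
by rewrite /r addSn !exprS !exprD; ring.
Qed.

(** * Laplacians of families of faces *)

Section Families.
Variables (R : realType) (T : finType).
Implicit Types (F G H : {set T}) (X Y D : {set {set T}}).

Local Notation inc := (incidence R).
Local Notation faces X i := (pair_faces X set0 i).

Lemma mem_faces X i F : (F \in faces X i) = (F \in X) && (Defs.dim F == i).
Proof. by rewrite inE setD0. Qed.

Lemma pair_facesE D D' i : pair_faces D D' i = faces (D :\: D') i.
Proof. by rewrite /pair_faces setD0. Qed.

Lemma incidence_neq0 F G : inc F G != 0 -> F \subset G.
Proof.
apply: contraNT => FG; rewrite /incidence big_pred0 // => v.
by apply: contraNF FG => /andP[_ /eqP <-]; exact: subD1set.
Qed.

Lemma incidence_set0 (v : T) : inc (set0 : {set T}) [set v] = 1.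
Proof.
rewrite /incidence (big_pred1 v) => [|w]; last first.
  by rewrite in_set1 /=; case: (w =P v) => //= ->; rewrite setDv eqxx.
rewrite (_ : [set u in _ | _] = set0) ?cards0 ?expr0 //.
by apply/setP=> u; rewrite !inE; case: (u =P v) => // ->; rewrite ltnn.
Qed.

(** A pair enters only through its set difference, so [X] is any family, not necessarily closed
    under subsets. Indexing by sets lets entries of different families be compared without casts. *)
Definition lap_entry X (i : int) F G : R :=
  \sum_(H in faces X (i + 1)) inc F H * inc G H
  + \sum_(H in faces X (i - 1)) inc H F * inc H G.

Definition lap_poly X i : {poly R} :=
  char_poly (set_mx (faces X i) (lap_entry X i)).

Lemma char_poly_laplacian D D' i :
  char_poly (laplacian R D D' i) = lap_poly (D :\: D') i.
Proof.
rewrite /lap_poly /lap_entry -!pair_facesE; congr char_poly.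
apply/matrixP=> a b; rewrite !mxE; congr (_ + _).
  by rewrite [RHS]big_enum_val; apply: eq_bigr => c _; rewrite !mxE.
by rewrite [RHS]big_enum_val; apply: eq_bigr => c _; rewrite !mxE.
Qed.

Lemma lap_poly_neq0 X i : lap_poly X i != 0.
Proof. by rewrite monic_neq0 // char_poly_monic. Qed.

Lemma facesU X Y i : faces (X :|: Y) i = faces X i :|: faces Y i.
Proof. by apply/setP=> F; rewrite in_setU !mem_faces in_setU andb_orl. Qed.

(** Incidences across the two families then vanish. An empty face in one family would be contained
    in every face of the other, which is why it has to be removed first. *)
Definition unrelated X Y :=
  forall F G, F \in X -> G \in Y -> ~~ (F \subset G) && ~~ (G \subset F).

Lemma unrelated_sym X Y : unrelated X Y -> unrelated Y X.
Proof. by move=> XY F G FY GX; rewrite andbC XY. Qed.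

Lemma unrelated_disjoint X Y : unrelated X Y -> [disjoint X & Y].
Proof.
move=> XY; rewrite disjoint_subset; apply/subsetP=> F FX.
by apply/negP=> FY; have := XY F F FX FY; rewrite subxx.
Qed.

Lemma unrelated_faces X Y i :
  unrelated X Y -> unrelated (faces X i) (faces Y i).
Proof.
by move=> XY F G; rewrite !mem_faces => /andP[FX _] /andP[GY _]; exact: XY.
Qed.

Lemma unrelated_incidence X Y F G :
  unrelated X Y -> F \in X -> G \in Y -> inc F G = 0 /\ inc G F = 0.
Proof.
move=> XY FX GY; have /andP[FG GF] := XY F G FX GY.
by split; apply/eqP; [apply: contraNT FG | apply: contraNT GF];
  exact: incidence_neq0.
Qed.

(** A face of [Y] has zero incidence with [F], so it adds nothing to either sum. *)
Lemma lap_entryU X Y i F G :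
  unrelated X Y -> F \in X -> lap_entry (X :|: Y) i F G = lap_entry X i F G.
Proof.
move=> XY FX.
have sumU j (f : {set T} -> R) : (forall H, H \in Y -> f H = 0) ->
    \sum_(H in faces (X :|: Y) j) f H = \sum_(H in faces X j) f H.
  move=> f0; rewrite (big_setID (faces X j)) facesU setUC setIUl setIid /=.
  rewrite (setUidPr (subsetIr _ _)) [X in _ + X]big1 ?addr0 // => H.
  by rewrite in_setD in_setU !mem_faces => /andP[/negPf->]; rewrite orbF
    => /andP[/f0].
by rewrite /lap_entry !sumU // => H HY;
  have [FH HF] := unrelated_incidence XY FX HY; rewrite ?FH ?HF mul0r.
Qed.

Lemma lap_entry_unrelated X Y i F G :
  unrelated X Y -> F \in X -> G \in Y -> lap_entry X i F G = 0.
Proof.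
move=> XY FX GY; rewrite /lap_entry !big1 ?addr0 // => H;
  rewrite mem_faces => /andP[HX _].
  by rewrite (unrelated_incidence XY HX GY).1 mulr0.
by rewrite (unrelated_incidence XY HX GY).2 mulr0.
Qed.

Lemma lap_polyU X Y i :
  unrelated X Y -> lap_poly (X :|: Y) i = lap_poly X i * lap_poly Y i.
Proof.
move=> XY; have YX := unrelated_sym XY.
rewrite /lap_poly facesU char_poly_set_mxU.
- congr (_ * _); congr char_poly; apply: eq_set_mx => F G;
    rewrite !mem_faces => /andP[FX _] _; first exact: lap_entryU.
  by rewrite setUC lap_entryU.
- exact/unrelated_disjoint/unrelated_faces.
move=> F G; rewrite !mem_faces => /andP[FX _] /andP[GY _].
by rewrite lap_entryU // [in X in _ /\ X]setUC !lap_entryU //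
  (lap_entry_unrelated _ XY) // (lap_entry_unrelated _ YX).
Qed.

(** Locality in the dimension: removing the empty face can affect no Laplacian above dimension 0. *)
Lemma eq_lap_poly X Y i :
  (forall j, (j == i - 1) || (j == i) || (j == i + 1) ->
     faces X j = faces Y j) ->
  lap_poly X i = lap_poly Y i.
Proof.
move=> XY; rewrite /lap_poly /lap_entry.
by rewrite !XY ?eqxx ?orbT.
Qed.

(** * Spectrum polynomials of families *)

Definition qweight (x : R) : {malg int[tqmonom R]} := qpow `|x|%:nng.

Lemma qweight_nat n : qweight n%:R = qvar ^+ n.
Proof.
elim: n => [|n IH].
  rewrite expr0 /qweight /qpow -[RHS]/(<< mone >>); congr << TQ (_, _) >>.
  by apply/val_inj; rewrite /= normr0.
rewrite exprS -IH /qweight /qvar /qpow malgU_mul; congr << _ >>.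
congr TQ; congr (_, _); apply/val_inj => /=.
by rewrite !normr_nat mulrS.
Qed.

Lemma spectrum_polyE D D' :
  spectrum_poly R D D' = \sum_(0 <= i < #|T|.+1)
    tvar ^+ i * root_sum qweight (lap_poly (D :\: D') (i%:Z - 1)).
Proof.
rewrite big_mkord; apply: eq_bigr => i _; rewrite /spectrum (sum_eigenvalues qweight).
by rewrite char_poly_laplacian.
Qed.

Lemma spectrum_poly_setD D D' :
  spectrum_poly R D D' = spectrum_poly R (D :\: D') set0.
Proof. by rewrite !spectrum_polyE setD0. Qed.

Lemma spectrum_poly_set0 : spectrum_poly R (@set0 {set T}) set0 = 0.
Proof.
rewrite spectrum_polyE big1 // => i _; rewrite setD0 /lap_poly.
have -> : faces (@set0 {set T}) (i%:Z - 1) = set0.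
  by apply/setP=> F; rewrite mem_faces !inE.
by rewrite char_poly_set_mx0 root_sum1 mulr0.
Qed.

Lemma spectrum_polyU X Y :
  unrelated X Y ->
  spectrum_poly R (X :|: Y) set0 =
    spectrum_poly R X set0 + spectrum_poly R Y set0.
Proof.
move=> XY; rewrite !spectrum_polyE -big_split; apply: eq_bigr => i _ /=.
by rewrite !setD0 lap_polyU // root_sumM ?lap_poly_neq0 // mulrDr.
Qed.

(** * Removal of the empty face *)

Lemma incidence_sum_edge X H :
  #|H| = 2 -> {in H, forall v, H :\ v \in X} -> \sum_(G in X) inc G H = 0.
Proof.
move=> H2 HX; rewrite /incidence.
rewrite (exchange_big_dep (mem H)) /=; last by move=> G v _ /andP[].
rewrite (eq_bigr (fun v =>
    (-1) ^+ #|[set u in H | (enum_rank u < enum_rank v)%N]|)); last first.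
  move=> v vH; rewrite (big_pred1 (H :\ v)) // => G.
  by rewrite vH /= andbC eq_sym; case: eqP => //= ->; rewrite HX.
have /cards2P[a [b [ab ->]]] : #|H| == 2 by rewrite H2.
(* By symmetry [a] comes first. Removing [a] then carries the sign 1 and removing [b] the sign -1,
   so the boundary coefficients of an edge cancel. *)
wlog lt_ab : a b ab / (enum_rank a < enum_rank b)%N.
  move=> IH; have [lt_ab|lt_ba|eq_ab] := ltngtP (enum_rank a) (enum_rank b).
  - exact: IH.
  - by rewrite setUC IH // eq_sym.
  - by rewrite (enum_rank_inj (val_inj eq_ab)) eqxx in ab.
rewrite big_setU1 ?inE // big_set1 /=.
have -> : [set u in [set a; b] | (enum_rank u < enum_rank a)%N] = set0.
  apply/setP=> u; rewrite !inE; apply/negP=> /andP[/orP[]/eqP-> ].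
    by rewrite ltnn.
  by rewrite ltnNge ltnW.
have -> : [set u in [set a; b] | (enum_rank u < enum_rank b)%N] = [set a].
  apply/setP=> u; rewrite !inE; case: (u =P a) => [->|_] //=.
  by case: (u =P b) => [->|_] //=; rewrite ltnn.
by rewrite cards0 cards1 expr0 expr1 subrr.
Qed.

Lemma mem_faces0 X F : F \in faces X 0 -> exists2 v, F = [set v] & [set v] \in X.
Proof.
rewrite mem_faces => /andP[FX /eqP F0].
have /cards1P[v Fv] : #|F| == 1%N by move: F0; rewrite /Defs.dim; lia.
by exists v; rewrite -?Fv.
Qed.

Lemma faces_setD0 X i : i != -1 -> faces (X :\ set0) i = faces X i.
Proof.
move=> i1; apply/setP=> F; rewrite !mem_faces in_setD1.
have [->|//] := eqVneq F set0; rewrite /= /Defs.dim cards0 sub0r.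
by rewrite eq_sym (negPf i1) andbF.
Qed.

Lemma faces_setD0N1 X : faces (X :\ set0) (-1) = set0.
Proof.
apply/setP=> F; rewrite mem_faces in_setD1 in_set0 -cards_eq0 /Defs.dim.
by case: #|F| => //= n; apply/negbTE; rewrite andbC; apply/nandP; left; lia.
Qed.

Lemma facesN2 X : faces X (-1 - 1) = set0.
Proof.
by apply/setP=> F; rewrite mem_faces in_set0 /Defs.dim; apply/nandP; right; lia.
Qed.

Lemma facesN1 X : set0 \in X -> faces X (-1) = [set set0].
Proof.
move=> X0; apply/setP=> F; rewrite mem_faces in_set1 -cards_eq0 /Defs.dim.
have -> : (#|F|%:Z - 1 == -1) = (#|F| == 0)%N by lia.
by rewrite cards_eq0; case: eqP => [->|_]; rewrite ?X0 ?andbF.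
Qed.

Lemma lap_polyN1 X :
  set0 \in X -> lap_poly X (-1) = 'X - #|faces X 0|%:R%:P.
Proof.
move=> X0; rewrite /lap_poly (facesN1 X0).
rewrite char_poly_set_mx1 /lap_entry facesN2 big_set0 addr0 addNr.
rewrite (eq_bigr (fun=> 1)) ?sumr_const // => F /mem_faces0[v -> _].
by rewrite incidence_set0 mulr1.
Qed.

Lemma lap_poly_setD0N1 X : lap_poly (X :\ set0) (-1) = 1.
Proof. by rewrite /lap_poly faces_setD0N1 char_poly_set_mx0. Qed.

(** Removing the empty face subtracts the all-ones matrix from the Laplacian
    on vertices, which leaves a graph Laplacian, killed by the all-ones
    vector. *)
Lemma lap_poly_setD0_0 V D :
  simplicial_complex V D -> set0 \in D ->
  'X * lap_poly D 0 = ('X - #|faces D 0|%:R%:P) * lap_poly (D :\ set0) 0.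
Proof.
move=> [_ Dsub] D0; rewrite /lap_poly (faces_setD0 D (isT : 0 != -1 :> int)).
rewrite -char_poly_add_const.
  congr (_ * char_poly _); apply/matrixP=> a b; rewrite !mxE /lap_entry.
  rewrite !sub0r faces_setD0 // faces_setD0N1 big_set0 addr0; congr (_ + _).
  rewrite (facesN1 D0) big_set1; have [v -> _] := mem_faces0 (enum_valP a).
  by have [w -> _] := mem_faces0 (enum_valP b); rewrite !incidence_set0 mulr1.
apply/matrixP=> a b; rewrite !mxE.
transitivity (\sum_(G in faces D 0) lap_entry (D :\ set0) 0 (enum_val a) G).
  by rewrite [RHS]big_enum_val; apply: eq_bigr => c _; rewrite !mxE mulr1.
rewrite /lap_entry sub0r faces_setD0N1.
under eq_bigr do rewrite big_set0 addr0.
(* After the exchange, an edge [H] contributes its incidence with the row vertex times the sum of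
   its boundary coefficients, which is 0. *)
rewrite exchange_big big1 // => H; rewrite mem_faces in_setD1.
move=> /andP[/andP[_ HD] /eqP H1].
have {H1}H2 : #|H| = 2 by move: H1; rewrite /Defs.dim; lia.
rewrite -mulr_sumr incidence_sum_edge ?mulr0 // => v vH.
rewrite mem_faces (Dsub _ _ HD (subD1set _ _)) /= /Defs.dim.
by move: (cardsD1 v H); rewrite vH H2; lia.
Qed.

Lemma spectrum_poly_setD0 V D :
  simplicial_complex V D -> set0 \in D ->
  spectrum_poly R D set0 = spectrum_poly R (D :\ set0) set0
    + qvar ^+ #|faces D 0| + tvar * (qvar ^+ #|faces D 0| - 1).
Proof.
move=> cD D0; rewrite !spectrum_polyE !setD0.
apply: (@sum_eq_from2 _ (fun i => root_sum qweight (lap_poly D (i%:Z - 1)))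
  (fun i => root_sum qweight (lap_poly (D :\ set0) (i%:Z - 1)))).
- by rewrite sub0r (lap_polyN1 D0) root_sum_XsubC qweight_nat.
- by rewrite sub0r lap_poly_setD0N1 root_sum1.
- rewrite subrr.
  (* The factor ['X] stands for the eigenvalue 0, of weight 1; the other linear factor has weight
     [qvar] to the number of vertices. *)
  have := congr1 (root_sum qweight) (lap_poly_setD0_0 cD D0).
  rewrite !root_sumM ?lap_poly_neq0 ?polyXsubC_eq0 ?polyX_eq0 //.
  rewrite root_sum_XsubC qweight_nat -['X]subr0 -polyC0 root_sum_XsubC.
  by rewrite -[qweight 0]/(qweight 0%:R) qweight_nat expr0.
(* Over an empty ambient type there are no vertices, so the power of [qvar] is 1. *)
- move=> T0; rewrite (_ : faces D 0 = set0) ?cards0 ?expr0 //.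
  apply/setP=> F; rewrite in_set0; apply/negP=> /mem_faces0[v _ _].
  by have := card0_eq T0 v; rewrite inE.
move=> i i2; congr root_sum; apply: eq_lap_poly => j j_i.
by rewrite faces_setD0 //; move: j_i i2; lia.
Qed.

End Families.

(** * The recursion for a disjoint union *)

Section DisjointUnion.
Variables (R : realType) (T : finType).
Implicit Types (V W F : {set T}) (D E : {set {set T}}).

Local Notation faces X i := (pair_faces X set0 i).

(** Deleting [e] changes nothing and the contraction has no faces, so the three terms reduce to q S
    + 0 + (1 - q) S. *)
Lemma spectral_recursion_at_loop D (e : T) :
  (forall F, F \in D -> e \notin F) -> spectral_recursion_at R D e.
Proof.
move=> De; rewrite /spectral_recursion_at.
have -> : deletion D e = D.
  by apply/setP=> F; rewrite inE; case: (boolP (F \in D)) => // /De ->.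
have -> : contraction D e = set0.
  apply/setP=> F; rewrite in_set0; apply/negP=> /imsetP[G].
  by rewrite inE => /andP[/De/negPf->].
rewrite spectrum_poly_set0 mulr0 addr0; exact: recursion_algebra0.
Qed.

(** Of two nested faces the smaller is their intersection, which is empty here. *)
Lemma unrelated_supports V W D E :
  [disjoint V & W] -> {in D, forall F, F \subset V} ->
  {in E, forall F, F \subset W} -> set0 \notin D -> set0 \notin E ->
  unrelated D E.
Proof.
move=> dVW DV EW D0 E0 F G FD GE.
have FG0 : F :&: G = set0.
  by apply/eqP; rewrite setI_eq0; apply: disjointW dVW; [exact: DV|exact: EW].
by apply/andP; split; apply: contraT; rewrite negbK => /setIidPl;
  rewrite ?[G :&: F]setIC FG0 => eq0; [move: D0 | move: E0]; rewrite eq0 ?FD ?GE.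
Qed.

Lemma spectrum_poly_disjointU V W D E :
  simplicial_complex V D -> simplicial_complex W E -> [disjoint V & W] ->
  set0 \in D -> set0 \in E ->
  spectrum_poly R (D :|: E) set0 =
    spectrum_poly R (D :\ set0) set0 + spectrum_poly R (E :\ set0) set0
    + qvar ^+ (#|faces D 0| + #|faces E 0|)
    + tvar * (qvar ^+ (#|faces D 0| + #|faces E 0|) - 1).
Proof.
move=> cD cE dVW D0 E0.
have DE : unrelated (D :\ set0) (E :\ set0).
  apply: (unrelated_supports dVW); rewrite ?setD11 //.
    by move=> F /setD1P[_ /(proj1 cD)].
  by move=> F /setD1P[_ /(proj1 cE)].
have DE0 : set0 \in D :|: E by rewrite in_setU D0.
rewrite (spectrum_poly_setD0 R (union_complex cD cE) DE0).
rewrite setDUl (spectrum_polyU R DE).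
suff -> : #|faces (D :|: E) 0| = (#|faces D 0| + #|faces E 0|)%N by [].
(* Vertices are counted with the empty face removed, where the two families are unrelated and hence
   disjoint. *)
rewrite facesU cardsU -(@faces_setD0 _ D 0) // -(@faces_setD0 _ E 0) //.
have /unrelated_disjoint := unrelated_faces (i := 0) DE.
by rewrite -setI_eq0 => /eqP ->; rewrite cards0 subn0.
Qed.

Lemma card_faces0_deletion D (e : T) :
  [set e] \in D -> #|faces D 0| = #|faces (deletion D e) 0|.+1.
Proof.
move=> De; rewrite (cardsD1 [set e]) mem_faces De /= /Defs.dim cards1 subrr eqxx.
congr _.+1; apply: eq_card => F; rewrite in_setD1 !mem_faces inE.
apply/andP/andP=> [[Fe /andP[FD F0]]|[/andP[FD eF] F0]].
  have F0' : F \in faces D 0 by rewrite mem_faces FD.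
  have [v Fv _] := mem_faces0 F0'; split=> //; rewrite FD /= Fv in_set1.
  by apply: contraNneq Fe => ->; rewrite Fv.
rewrite FD F0; split=> //; apply: contraNneq eF => ->; exact: set11.
Qed.

(** No face of [E] contains [e], so the union has the contraction of [D], and [E] is simply added to
    its deletion. As [e] spans a face, the contraction has the empty face and the deletion has one
    vertex fewer. *)
Lemma spectral_recursion_at_disjointU V W D E (e : T) :
  simplicial_complex V D -> simplicial_complex W E -> [disjoint V & W] ->
  [set e] \in D -> set0 \in E ->
  spectral_recursion_at R D e -> spectral_recursion_at R (D :|: E) e.
Proof.
move=> cD cE dVW De E0; rewrite /spectral_recursion_at.
have D0 : set0 \in D by case: (cD) => _ /(_ _ _ De); apply; exact: sub0set.
have eV : e \in V by rewrite -sub1set; apply: (proj1 cD).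
have eE F : F \in E -> e \notin F.
  by move=> /(proj1 cE)/subsetP FW; apply/negP=> /FW; rewrite (disjointFr dVW eV).
have cdel := deletion_complex e cD; have ccon := contraction_complex e cD.
have del0 : set0 \in deletion D e by rewrite inE D0 in_set0.
have con0 : set0 \in contraction D e.
  by apply/imsetP; exists [set e]; rewrite ?setDv ?inE ?De ?eqxx.
have -> : deletion (D :|: E) e = deletion D e :|: E.
  apply/setP=> F; rewrite !inE; case: (boolP (F \in E)) => [/eE ->|_].
    by rewrite !orbT.
  by rewrite !orbF.
have -> : contraction (D :|: E) e = contraction D e.
  rewrite /contraction.
  suff -> : [set F in D :|: E | e \in F] = [set F in D | e \in F] by [].
  apply/setP=> F; rewrite !inE.
  by case: (boolP (F \in E)) => [/eE/negPf->|_]; rewrite ?andbF ?orbF.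
have dVeW : [disjoint V :\ e & W] by apply: disjointWl dVW; exact: subD1set.
have unr : unrelated (deletion D e :\: contraction D e) (E :\ set0).
  apply: (unrelated_supports dVeW); rewrite ?setD11 //.
  - by move=> F /setDP[/(proj1 cdel)].
  - by move=> F /setD1P[_ /(proj1 cE)].
  - by rewrite in_setD con0.
(* A face common to [E] and the contraction lies in both [W] and [V :\ e], so only the empty face is
   shared. *)
have EconE : E :\: contraction D e = E :\ set0.
  apply/setP=> F; rewrite in_setD in_setD1.
  case: (boolP (F \in E)) => [FE|_]; rewrite ?andbF // !andbT; congr (~~ _).
  apply/idP/eqP=> [Fc|->//]; apply/eqP; rewrite -subset0.
  move: dVeW; rewrite -setI_eq0 => /eqP <-.
  by rewrite subsetI (proj1 ccon _ Fc) (proj1 cE _ FE).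
have -> : spectrum_poly R (deletion D e :|: E) (contraction D e)
    = spectrum_poly R (deletion D e) (contraction D e)
      + spectrum_poly R (E :\ set0) set0.
  rewrite spectrum_poly_setD setDUl EconE (spectrum_polyU R unr).
  by rewrite -(spectrum_poly_setD R (deletion D e)).
rewrite (spectrum_poly_disjointU cD cE dVW D0 E0).
rewrite (spectrum_poly_disjointU cdel cE dVeW del0 E0).
rewrite (spectrum_poly_setD0 R cD D0) (spectrum_poly_setD0 R cdel del0).
rewrite (card_faces0_deletion De); exact: recursion_algebra.
Qed.

End DisjointUnion.

Theorem corollary6p11 (R : realType) (T : finType) (V W : {set T})
    (Delta Gamma : {set {set T}}) :
  simplicial_complex V Delta ->
  simplicial_complex W Gamma ->
  [disjoint V & W] ->
  spectral_recursion R V Delta ->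
  spectral_recursion R W Gamma ->
  spectral_recursion R (V :|: W) (Delta :|: Gamma).
Proof.
(* The vertex is taken in the first complex; commutativity of the union covers the other case. *)
have half (A B : {set T}) (D E : {set {set T}}) (e : T) :
    simplicial_complex A D -> simplicial_complex B E -> [disjoint A & B] ->
    spectral_recursion R A D -> e \in A -> spectral_recursion_at R (D :|: E) e.
  move=> cD cE dAB rD eA; have [De|De] := boolP ([set e] \in D); last first.
    apply: spectral_recursion_at_loop => F; rewrite inE => /orP[FD|FE].
      by apply: contra De => eF; apply: (proj2 cD) FD _; rewrite sub1set.
    apply/negP=> eF; have /subsetP/(_ e eF) := proj1 cE _ FE.
    by rewrite (disjointFr dAB eA).
  (* The complex without faces has no empty face to share, but then the union is [D] itself. *)
  have [E0|/set0Pn[F FE]] := eqVneq E set0; first by rewrite E0 setU0; exact: rD.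
  apply: (spectral_recursion_at_disjointU cD cE dAB De _ (rD e eA)).
  by apply: (proj2 cE) FE _; exact: sub0set.
move=> cD cE dVW rD rE e; rewrite inE => /orP[eV|eW].
  exact: half cD cE dVW rD eV.
by rewrite setUC; apply: half cE cD _ rE eW; rewrite disjoint_sym.
Qed.
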